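(* Let $m,n \geq 4$ be integers and let $G=G_{n,m}$ be the $n\times m$ grid graph. For every connected dominating set $S$ of $G$, \[ |S| \geq \left\lceil \frac{mn+\left\lceil\frac{3}{2}\left\lceil \frac{\min \{m,n\}}{3}\right\rceil\right\rceil+1}{3}\right\rceil . \]
   Context: The grid graph $G_{n,m}$ has vertex set $\{1,\dots,n\}\times\{1,\dots,m\}$, with $(i_1,j_1)$ and $(i_2,j_2)$ adjacent iff $|i_1-i_2|+|j_1-j_2|=1$. A connected dominating set of a graph $G=(V,E)$ is a set $S \subseteq V$ such that $G[S]$ is connected and every vertex of $V$ is in $S$ or adjacent to a vertex of $S$. *)

(* Defs.v *)
From mathcomp Require Import all_boot all_order all_algebra.

Set Implicit Arguments.
Unset Strict Implicit.
Unset Printing Implicit Defensive.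

Section Domination.

Variables (T : finType) (e : rel T).

Definition induced (S : {set T}) : rel T :=
  [rel x y | [&& x \in S, y \in S & e x y]].

(* The induced relation lives on T but has no edge leaving S, so between
   vertices of S the walks it allows are exactly those of the graph G[S].
   The empty set counts as connected. *)
Definition connected_in (S : {set T}) : bool :=
  [forall x in S, forall y in S, connect (induced S) x y].

Definition dominating (S : {set T}) : bool :=
  [forall x, (x \in S) || [exists y in S, e x y]].

Definition connected_dominating (S : {set T}) : bool :=
  connected_in S && dominating S.

End Domination.

Local Open Scope ring_scope.

(* Rows and columns are numbered from 0 instead of 1. *)
Definition grid_adj (n m : nat) : rel ('I_n * 'I_m) :=
  [rel u v : 'I_n * 'I_m | `|u.1%:Z - v.1%:Z| + `|u.2%:Z - v.2%:Z| == 1].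

(* Main.v *)
From HB Require Import structures.
Require Import Defs.
From mathcomp Require Import all_boot all_order all_algebra zify lra.

Set Implicit Arguments.
Unset Strict Implicit.
Unset Printing Implicit Defensive.

Import GRing.Theory Num.Theory Order.TTheory.

(* Let s = |S| and let E be the number of edges of G[S]. Counting the neighbours
   in S of every vertex gives 4s - b, where b is the number of neighbours that S
   lacks beyond the sides of the grid; dominating the four grid corners forces
   b >= 4. Call a pair of perpendicular edges of G[S] at a common vertex a turn,
   and charge it to the fourth vertex of its unit square. If that vertex u is
   outside S then it receives at most deg_S(u) - 1 turns, with one exception:
   it receives 4 turns with deg_S(u) = 4 if its 8 surrounding vertices are all
   in S (a hole). If u is in S then the square is full (a block), and every
   block receives 4 turns. Hence, with C turns, B blocks and Q holes,
     nm + 4 + C + 2E <= 5s + 4B + Q.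
   Deleting a suitable edge of each block and of each hole leaves G[S] connected,
   so E >= s - 1 + B + Q. Finally C >= 2 E_v - 2 I_h, where E_v counts the vertical
   edges and I_h the vertices of S without horizontal neighbour, and symmetrically.
   Together these give 3s >= nm + 2H and 3s >= nm + 2V, where H and V are the
   numbers of maximal horizontal and vertical segments of S with at least two
   vertices.
   Either every row is within distance 1 of a row containing a horizontal
   segment, so that 3H >= n, or some row i is not; then every vertex of row i is
   dominated by a vertex lying on a vertical segment, so that 3V >= m. *)

(** * Edges of a connected graph *)

Lemma connected_edge_bound (T : finType) (e : rel T) (A : {set T}) :
  symmetric e -> (forall x y, e x y -> (x \in A) && (y \in A)) ->
  {in A &, forall x y, connect e x y} ->
  2 * #|A| <= #|[set z : T * T | e z.1 z.2]| + 2.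
Proof.
move=> eC eA conA.
have [-> | [r rA]] := set_0Vmem A; first by rewrite cards0.
(* [B] grows from [r] one vertex at a time: connectivity supplies an edge leaving [B], and this edge
   contributes two ordered pairs. *)
suff grow k : k < #|A| -> exists B : {set T},
    [/\ B \subset A, r \in B, #|B| = k.+1 &
      2 * k <= #|[set z | [&& z.1 \in B, z.2 \in B & e z.1 z.2]]|].
  have A_gt0 : 0 < #|A| by apply/card_gt0P; exists r.
  have [|B [_ _ _ leB]] := grow #|A|.-1; first by rewrite prednK.
  have: #|[set z | [&& z.1 \in B, z.2 \in B & e z.1 z.2]]|
      <= #|[set z : T * T | e z.1 z.2]|.
    by apply/subset_leq_card/subsetP => z; rewrite !inE => /and3P[].
  lia.
elim: k => [|k IHk] ltk.
  by exists [set r]; rewrite sub1set set11 cards1.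
have [B [sBA rB cardB leB]] := IHk (ltnW ltk).
have [y yA yB] : exists2 y, y \in A & y \notin B.
  by apply/subsetPn; apply: contraTN ltk => /subset_leq_card; rewrite cardB -leqNgt.
have [/existsP[w /andP[wB /existsP[u /andP[uB ewu]]]] | noexit] :=
    boolP [exists w, (w \in B) && [exists u, (u \notin B) && e w u]]; last first.
  have clB : closed e (mem B).
    apply: (intro_closed (sym_connect_sym eC)) => w u ewu wB; apply: contraNT noexit => uB.
    by apply/existsP; exists w; rewrite wB; apply/existsP; exists u; rewrite uB.
  have: (r \in B) = (y \in B) := closed_connect clB (conA r y rA yA).
  by rewrite rB (negPf yB).
have /andP[_ uA] := eA _ _ ewu.
exists (u |: B); split.
- by rewrite subUset sub1set uA.
- by rewrite !inE rB orbT.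
- by rewrite cardsU1 uB cardB.
set D := [set z | _] in leB; set D' := [set z | _].
have: [set (w, u); (u, w)] :|: D \subset D'.
  apply/subsetP => -[a b]; rewrite !inE /= !xpair_eqE.
  case/orP => [/orP[] /andP[/eqP-> /eqP->] | /and3P[-> -> ->]]; rewrite ?orbT //.
    by rewrite ewu wB eqxx orbT.
  by rewrite eC ewu wB eqxx orbT.
move/subset_leq_card; rewrite cardsU.
have -> : [set (w, u); (u, w)] :&: D = set0.
  apply/setP => -[a b]; rewrite !inE /= !xpair_eqE.
  by apply: contraNF uB => /andP[/orP[] /andP[/eqP-> /eqP->] /and3P[]].
rewrite cards0 cards2 xpair_eqE.
have /negPf -> : w != u by apply: contraNneq uB => <-.
rewrite subn0 /= => leD; by apply: leq_trans leD; rewrite mulnS leq_add2l.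
Qed.

(** * Turns, blocks and holes in a finite abelian group *)

Section TorusCount.
Variables (T : finZmodType) (r d : T) (A G : {set T}).

Local Open Scope ring_scope.
Local Open Scope nat_scope.

Local Notation x p := (p%R \in A).

Definition nbrs (a p : T) : nat := x (p + a) + x (p - a).
Definition edge (a p : T) := x p && x (p + a).
Definition corner (a b p : T) := [&& x (p + a), x (p + b) & x (p + a + b)].
(** The turns charged to [p]; if [p] is in [A], these are the blocks around it. *)
Definition corners p : nat :=
  corner r d p + corner (- r) d p + corner r (- d) p + corner (- r) (- d) p.
Definition block (a b p : T) := x p && corner a b p.
Definition hole p :=
  [&& p \notin A, x (p + r), x (p - r), x (p + d), x (p - d),
      x (p + r + d), x (p - r + d), x (p + r - d) & x (p - r - d)].

Definition nedges a := \sum_p edge a p.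
Definition nblocks a b := \sum_p block a b p.
Definition nholes := \sum_p hole p.
Definition nturns a b := \sum_p x p * (nbrs a p * nbrs b p).
Definition isolated a := \sum_p [&& x p, ~~ x (p + a) & ~~ x (p - a)].
(** A maximal segment with at least two vertices is counted at its last vertex, so [ends r] is H and
    [ends d] is V. *)
Definition ends a := \sum_p [&& x p, ~~ x (p + a) & x (p - a)].

Lemma sum_shift (t : T) (F : T -> nat) : \sum_p F (p + t)%R = \sum_p F p.
Proof. by rewrite [RHS](reindex_inj (addIr t)). Qed.

Lemma sum_mem (t : T) : \sum_p x (p + t) = #|A|.
Proof. by rewrite (sum_shift t (fun p => x p)) -sum1_card [RHS]big_mkcond. Qed.

Lemma nedgesN a : nedges (- a) = nedges a.
Proof.
rewrite -[LHS](sum_shift a); apply: eq_bigr => p _.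
by rewrite /edge addrK andbC.
Qed.

(** Translation by [a + b] moves the count from the fourth vertex of a square to the vertex where
    the turn is made. *)
Lemma sum_corner a b :
  \sum_p corner a b p = \sum_p [&& x p, x (p - a) & x (p - b)].
Proof.
rewrite -[RHS](sum_shift (a + b)%R); apply: eq_bigr => p _.
by rewrite /corner !addrA addrK (addrAC p a b) addrK; do 3!case: (_ \in A).
Qed.

Lemma nblocksN a b : nblocks (- a) b = nblocks a b.
Proof.
rewrite -[LHS](sum_shift a); apply: eq_bigr => p _.
by rewrite /block /corner !addrK; do 4!case: (_ \in A).
Qed.

Lemma nblocksC a b : nblocks a b = nblocks b a.
Proof.
apply: eq_bigr => p _; rewrite /block /corner (addrAC p).
by do 4!case: (_ \in A).
Qed.

Lemma sum_blocks : \sum_p x p * corners p = 4 * nblocks r d.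
Proof.
transitivity (nblocks r d + nblocks (- r) d + nblocks r (- d) + nblocks (- r) (- d)).
  rewrite /nblocks -!big_split; apply: eq_bigr => p _ /=.
  by rewrite /block /corners; case: (_ \in A); rewrite ?mul1n.
have sN a b : nblocks a (- b) = nblocks a b by rewrite nblocksC nblocksN nblocksC.
rewrite !sN !nblocksN; lia.
Qed.

Lemma sum_corners : \sum_p corners p = nturns r d.
Proof.
rewrite !big_split /= !sum_corner -!big_split; apply: eq_bigr => p _ /=.
by rewrite /nbrs !opprK; do 5!case: (_ \in A).
Qed.

Lemma sum_deg : \sum_p (nbrs r p + nbrs d p) = 4 * #|A|.
Proof. by rewrite !big_split /= !sum_mem; set s := #|A|; lia. Qed.

Lemma sum_nbrs a : \sum_p x p * nbrs a p = 2 * nedges a.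
Proof.
rewrite mul2n -addnn -{2}nedgesN -big_split; apply: eq_bigr => p _ /=.
by rewrite /nbrs /edge; do 3!case: (_ \in A).
Qed.

Lemma nturnsC a b : nturns a b = nturns b a.
Proof. by apply: eq_bigr => p _; rewrite [nbrs a p * _]mulnC. Qed.

Lemma runs_count a : #|A| = nedges a + isolated a + ends a.
Proof.
rewrite -[LHS](sum_mem 0%R) -!big_split; apply: eq_bigr => p _ /=.
by rewrite addr0 /edge; do 3!case: (_ \in A).
Qed.

(** A vertex with an [a]-neighbour makes at least one turn for each of its [b]-neighbours; any other
    vertex has at most two [b]-neighbours, paid for by [isolated]. *)
Lemma turns_ge a b : 2 * nedges b <= nturns a b + 2 * isolated a.
Proof.
rewrite -sum_nbrs big_distrr -big_split; apply: leq_sum => p _ /=.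
by rewrite /nbrs; do 5!case: (_ \in A).
Qed.

(** Indexes a hole by a corner of its ring instead of its centre, so that holes and blocks are both
    indexed by the start of the row edge to delete. *)
Definition hole_at p := hole (p + r + d)%R.

Lemma hole_atE p : hole_at p = [&& (p + r + d)%R \notin A, x (p + r + r + d),
  x (p + d), x (p + r + d + d), x (p + r),
  x (p + r + r + d + d), x (p + d + d), x (p + r + r) & x p].
Proof.
by rewrite /hole_at /hole (addrAC _ d r) (addrAC _ d (- r)%R) !addrK.
Qed.

Lemma sum_hole_at : \sum_p hole_at p = nholes.
Proof.
rewrite -[RHS](sum_shift (r + d)%R); apply: eq_bigr => p _.
by rewrite /hole_at addrA.
Qed.

Hypothesis sAG : A \subset G.
Hypothesis dom : forall p, p \in G ->
  [|| x p, x (p + r), x (p - r), x (p + d) | x (p - d)].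
(** Off the grid the neighbours in [A] lie along one direction only, so no turn is charged there. *)
Hypothesis outside : forall p, p \notin G -> (nbrs r p == 0) || (nbrs d p == 0).
Hypothesis border : 4 <= \sum_(p | p \notin G) (nbrs r p + nbrs d p).

(** Turns charged to a gap of [G] join cyclically consecutive neighbours. As [dom] gives at least
    one neighbour, there are fewer turns than neighbours unless the whole ring is in [A], which is a
    hole. *)
Lemma local_count p :
  (p \notin A) * corners p + ((p \in G) && (p \notin A)) + (p \notin G) * (nbrs r p + nbrs d p)
   <= (p \notin A) * (nbrs r p + nbrs d p) + hole p.
Proof.
move: (@dom p) (@outside p) (subsetP sAG p).
rewrite /corners /corner /hole /nbrs.
case: (p \in G); case: (p \in A) => /= D O S; try by [];
  [move: (D isT) | move: (S isT) | move: (O isT)] => //;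
by do 8!case: (_ \in A).
Qed.

Lemma global_count :
  #|G| + 4 + nturns r d + 2 * nedges r + 2 * nedges d
    <= 5 * #|A| + 4 * nblocks r d + nholes.
Proof.
pose off F := \sum_p (p \notin A) * F p.
have split F : off F + \sum_p x p * F p = \sum_p F p.
  rewrite -big_split; apply: eq_bigr => p _ /=.
  by case: (_ \in A); rewrite /= ?mul1n ?mul0n ?addn0.
pose gap := \sum_p ((p \in G) && (p \notin A)).
have gapE : gap + #|A| = #|G|.
  rewrite -(cardsID A G) (setIidPr sAG) addnC; congr (_ + _).
  rewrite -sum1_card [RHS]big_mkcond; apply: eq_bigr => p _.
  by rewrite !inE andbC; case: (_ && _).
pose bd := \sum_p (p \notin G) * (nbrs r p + nbrs d p).
have bd_ge4 : 4 <= bd.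
  apply: leq_trans border _; rewrite big_mkcond; apply: leq_sum => p _.
  by case: (p \in G); rewrite /= ?mul1n.
have local : off corners + gap + bd <= off (fun p => nbrs r p + nbrs d p) + nholes.
  by rewrite -!big_split; apply: leq_sum => p _; apply: local_count.
have onE : \sum_p x p * (nbrs r p + nbrs d p) = 2 * nedges r + 2 * nedges d.
  rewrite -!sum_nbrs -big_split.
  by apply: eq_bigr => p _; rewrite mulnDr.
have := split corners; rewrite sum_blocks sum_corners => c1.
have := split (fun p => nbrs r p + nbrs d p); rewrite onE sum_deg => c2.
by move: c1 c2 local gapE bd_ge4; lia.
Qed.

(** * Deleting edges without disconnecting *)

(* Rules out that A winds around the torus in direction d. *)
Variable rk : T -> nat.
Hypothesis rk_d : forall p, p \in A -> x (p + d) -> rk (p + d)%R < rk p.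
Hypothesis rk_r : forall p, rk (p + r)%R = rk p.
Hypothesis conn : {in A &, forall p q, connect (induced
   (fun p q => (q - p)%R \in [:: r; - r; d; - d]%R) A) p q}.

(* Deletes the first row edge of every block and of every hole; on a graph cycle
   around a block or a hole the remaining edges lie further in direction d. *)
Definition kept p := edge r p && ~~ (block r d p || hole_at p).

Definition kept_adj (p q : T) :=
  [|| edge d p && (q == p + d)%R, edge d q && (p == q + d)%R,
      kept p && (q == p + r)%R | kept q && (p == q + r)%R].

Lemma kept_adjC : symmetric kept_adj.
Proof.
by move=> p q; rewrite /kept_adj; do 4!case: (_ && _).
Qed.

Lemma kept_adj_mem p q : kept_adj p q -> (p \in A) && (q \in A).
Proof.
by case/or4P => /andP[+ /eqP->];
  [move=> /andP[-> ->] | move=> /andP[-> ->]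
  | move=> /andP[/andP[-> ->] _] | move=> /andP[/andP[-> ->] _]].
Qed.

Lemma card_kept : #|[set z : T * T | kept_adj z.1 z.2]| <= 2 * nedges d + 2 * \sum_p kept p.
Proof.
have cnt (t : T) (P : T -> bool) : #|[set z : T * T | P z.1 && (z.2 == z.1 + t)%R]| <= \sum_p P p.
  rewrite -[leqRHS](_ : #|[set p | P p]| = _); last first.
    by rewrite -sum1_card [LHS]big_mkcond; apply: eq_bigr => p _; rewrite inE; case: (P p).
  rewrite -(card_imset _ (f := fun p => (p, p + t)%R)); last by move=> p q [].
  apply/subset_leq_card/subsetP => -[p q]; rewrite inE /= => /andP[Pp /eqP->].
  by apply/imsetP; exists p; rewrite ?inE.
have cntC (t : T) (P : T -> bool) : #|[set z : T * T | P z.2 && (z.1 == z.2 + t)%R]| <= \sum_p P p.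
  apply: leq_trans (cnt t P).
  rewrite -(card_imset _ (f := fun z : T * T => (z.2, z.1))); last by move=> [? ?] [? ?] [-> ->].
  apply/subset_leq_card/subsetP => -[p q] /imsetP[[a b]]; rewrite !inE /= => H [-> ->] //.
have := cnt d (edge d); have := cntC d (edge d).
have := cnt r kept; have := cntC r kept.
set S1 := [set z | _]; set S2 := [set z | _]; set S3 := [set z | _]; set S4 := [set z | _].
set S := [set z | _] => h1 h2 h3 h4.
have sS : S \subset S4 :|: S3 :|: S2 :|: S1.
  by apply/subsetP => z; rewrite !inE /kept_adj; do 4!case: (_ && _).
apply: leq_trans (subset_leq_card sS) _.
apply: leq_trans (leq_card_setU _ _) _.
rewrite !mul2n -!addnn !addnA; apply: leq_add h1.
apply: leq_trans (leq_card_setU _ _) _; apply: leq_add h2.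
by apply: leq_trans (leq_card_setU _ _) _; apply: leq_add h3.
Qed.

Lemma kept_count : \sum_p kept p + nblocks r d + nholes = nedges r.
Proof.
rewrite -sum_hole_at -!big_split; apply: eq_bigr => p _ /=.
rewrite /kept /block /corner hole_atE /edge.
by do 9!case: (_ \in A).
Qed.

(** Induction on [rk]: a deleted edge is bypassed around its block or hole, where the row edges on
    the far side have smaller rank. *)
Lemma kept_connect_r p : edge r p -> connect kept_adj p (p + r)%R.
Proof.
have vert q : edge d q -> connect kept_adj q (q + d)%R.
  by move=> e; apply: connect1; rewrite /kept_adj e eqxx.
have vertC q : edge d q -> connect kept_adj (q + d)%R q.
  by move=> e; apply: connect1; rewrite /kept_adj e eqxx !orbT.
have [k] := ubnP (rk p); elim: k p => // k IHk p ltk ep.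
have [kp | ] := boolP (kept p).
  by apply: connect1; rewrite /kept_adj kp eqxx !orbT.
rewrite /kept ep negbK => /orP[/and4P[pA prA pdA prdA] | ].
  apply: connect_trans (vert p _) _; first by rewrite /edge pA.
  apply: connect_trans (IHk _ _ _) _.
  - exact: leq_trans (rk_d pA pdA) ltk.
  - by rewrite /edge pdA addrAC.
  by rewrite addrAC; apply: vertC; rewrite /edge prA.
rewrite hole_atE => /and5P[cA prrdA pdA prddA /and5P[prA prrddA pddA prrA pA]].
have lt1 := rk_d pA pdA; have lt2 := rk_d pdA pddA.
apply: connect_trans (vert p _) _; first by rewrite /edge pA.
apply: connect_trans (vert _ _) _; first by rewrite /edge pdA.
have e1 : (p + d + d + r = p + r + d + d)%R by rewrite !(addrAC _ d r).
have e2 : (p + r + d + d + r = p + r + r + d + d)%R by rewrite !(addrAC _ d r).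
apply: connect_trans (IHk _ _ _) _; first exact: leq_trans (ltn_trans lt2 lt1) ltk.
  by rewrite /edge pddA e1.
rewrite e1; apply: connect_trans (IHk _ _ _) _; first by rewrite -e1 rk_r (leq_trans (ltn_trans lt2 lt1) ltk).
  by rewrite /edge prddA e2.
rewrite e2; apply: connect_trans (vertC _ _) _; first by rewrite /edge prrdA.
apply: connect_trans (vertC _ _) _; first by rewrite /edge prrA.
rewrite (sym_connect_sym kept_adjC); apply: connect1.
(* The second row edge of the hole survives: the centre [p + r + d] is missing, so [p + r] indexes
   neither a block nor a hole. *)
suff kpr : kept (p + r)%R by rewrite /kept_adj kpr eqxx !orbT.
rewrite /kept hole_atE /block /corner /edge prA prrA (negPf cA) /=.
by rewrite ?andbF ?orbF.
Qed.

Lemma edge_count : 2 * #|A| + 2 * nblocks r d + 2 * nholes <= 2 * nedges r + 2 * nedges d + 2.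
Proof.
have sub : subrel (induced (fun p q => (q - p)%R \in [:: r; - r; d; - d]%R) A)
                  (connect kept_adj).
  have e_d p : edge d p -> connect kept_adj p (p + d)%R.
    by move=> e; apply: connect1; rewrite /kept_adj e eqxx.
  move=> p q /and3P[pA qA]; rewrite !inE.
  case/or4P => /eqP /(canRL (subrK p)); rewrite addrC => eq_q.
  - by rewrite eq_q; apply: kept_connect_r; rewrite /edge pA -eq_q.
  - rewrite (sym_connect_sym kept_adjC) -[p in connect _ _ p](subrK r) -eq_q.
    by apply: kept_connect_r; rewrite /edge qA eq_q subrK.
  - by rewrite eq_q; apply: e_d; rewrite /edge pA -eq_q.
  rewrite (sym_connect_sym kept_adjC) -[p in connect _ _ p](subrK d) -eq_q.
  by apply: e_d; rewrite /edge qA eq_q subrK.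
have conK : {in A &, forall p q, connect kept_adj p q}.
  by move=> p q pA qA; apply: (connect_sub sub); apply: conn.
have kept_ge := connected_edge_bound kept_adjC kept_adj_mem conK.
have := leq_trans kept_ge (leq_add card_kept (leqnn 2)).
rewrite -kept_count; set s := #|A|; set k := \sum_p kept p; lia.
Qed.

(** Eliminating [isolated r] gives C >= 2E - 2s + 2H. Then 4E >= 4s - 4 + 4B + 4Q cancels the blocks
    and the constant 4 in [global_count]. *)
Lemma area_bound_r : #|G| + 2 * ends r <= 3 * #|A|.
Proof.
move: global_count edge_count (runs_count r) (turns_ge r d).
set s := #|A|; lia.
Qed.

Lemma area_bound_d : #|G| + 2 * ends d <= 3 * #|A|.
Proof.
move: global_count edge_count (runs_count d) (turns_ge d r).
rewrite (nturnsC d); set s := #|A|; lia.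
Qed.

End TorusCount.

(** * Ends of segments and covering by three translates *)

Section Runs.
Variables (T : finZmodType) (A : {set T}).
Local Open Scope nat_scope.

(** The decrease of [rk] keeps the segment from closing up; [f] will be the coordinate that is
    constant along it. *)
Lemma run_has_end (X : Type) (a : T) (f : T -> X) (rk : T -> nat) p :
  (forall q, f (q + a)%R = f q) ->
  (forall q, q \in A -> (q + a)%R \in A -> rk (q + a)%R < rk q) ->
  edge A a p ->
  exists q, f q = f p /\ [&& q \in A, (q + a)%R \notin A & (q - a)%R \in A].
Proof.
move=> fE rkE; have [k] := ubnP (rk p); elim: k p => // k IHk p ltk /andP[pA paA].
have [paaA | paaN] := boolP ((p + a + a)%R \in A).
  have [||q [fq qend]] := IHk (p + a)%R; first exact: leq_trans (rkE _ pA paA) ltk.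
    by rewrite /edge paA.
  by exists q; rewrite fq fE.
by exists (p + a)%R; rewrite fE paA paaN addrK.
Qed.

Lemma card_ends_ge (X : finType) (a : T) (f : T -> X) :
  #|[set f p | p in [set p | [&& p \in A, (p + a)%R \notin A & (p - a)%R \in A]]]| <= ends A a.
Proof.
apply: leq_trans (leq_imset_card _ _) _.
rewrite -sum1_card big_mkcond; apply: leq_sum => p _.
by rewrite inE; case: ifP.
Qed.

Lemma card_three_translates N (R : {set 'I_N.+1}) (u : 'I_N.+1) :
  (forall i, i != 0%R -> [|| i \in R, (i + u)%R \in R | (i - u)%R \in R]) ->
  N <= 3 * #|R|.
Proof.
move=> cov.
have sub : [set~ 0%R] \subset R :|: [set (i - u)%R | i in R] :|: [set (i + u)%R | i in R].
  apply/subsetP => i; rewrite !inE => /cov /or3P[-> // | iR | iR].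
    by rewrite (_ : i \in imset _ _) ?orbT //; apply/imsetP; exists (i + u)%R; rewrite ?addrK.
  by rewrite (_ : i \in [set (i + u)%R | i in R]) ?orbT //; apply/imsetP; exists (i - u)%R; rewrite ?subrK.
have := subset_leq_card sub; rewrite cardsC1 card_ord /= => le1.
apply: leq_trans le1 _; apply: leq_trans (leq_card_setU _ _) _.
rewrite !mulSn mul0n addn0 addnA; apply: leq_add (leq_imset_card _ _).
by apply: leq_trans (leq_card_setU _ _) _; rewrite leq_add2l leq_imset_card.
Qed.

End Runs.

(** * Indices modulo N + 1 *)

Section Inord.
Local Open Scope nat_scope.

(** For j = N the right side is out of range and [inord] defaults to 0, which is exactly the
    wrap-around of addition. *)
Lemma inord_succ N j : 0 < N -> j <= N -> (inord j + inord 1)%R = inord j.+1 :> 'I_N.+1.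
Proof.
move=> N0 jN; apply: val_inj; rewrite /= !val_insubd /= ltnS jN ltnS N0 ltnS.
by case: ltngtP jN => // [lt|->] _; rewrite addn1 ?modnn // modn_small.
Qed.

Lemma inord_pred N j : 0 < N -> 0 < j <= N -> (inord j - inord 1)%R = inord j.-1 :> 'I_N.+1.
Proof.
move=> N0 /andP[j0 jN]; rewrite -{1}(prednK j0) -inord_succ ?addrK //; lia.
Qed.

Lemma inord_out N j : N < j -> inord j = 0%R :> 'I_N.+1.
Proof. by move=> ltN; apply: val_inj; rewrite /= val_insubd /= ltnNge ltN. Qed.

Lemma inord_pred0 N : 0 < N -> (inord 0 - inord 1)%R = inord N :> 'I_N.+1.
Proof.
move=> N0; apply: (canLR (addrK _)).
by rewrite inord_succ // (inord_out (ltnSn N)); apply: val_inj; rewrite /= inordK.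
Qed.

End Inord.

(** * The grid inside a padded torus *)

HB.instance Definition _ (n m : nat) := GRing.Zmodule.on ('I_n.+1 * 'I_m.+1)%type.

Section Grid.
Local Open Scope nat_scope.
Variables (n m : nat) (n4 : 4 <= n) (m4 : 4 <= m).
Let T : finZmodType := ('I_n.+1 * 'I_m.+1)%type.
Variable S : {set 'I_n * 'I_m}.
Hypothesis cdS : connected_dominating (@grid_adj n m) S.

(* The grid sits in the torus Z/(n+1) x Z/(m+1), with row 0 and column 0 as
   padding, so that sums over T are invariant under translations. *)
Definition emb (u : 'I_n * 'I_m) : T := (inord u.1.+1, inord u.2.+1).
Definition tset : {set T} := emb @: S.
Definition tgrid : {set T} := setX [set~ 0%R] [set~ 0%R].
Definition rstep : T := (inord 0, inord 1).
Definition dstep : T := (inord 1, inord 0).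

Local Notation A := tset.
Local Notation G := tgrid.
Local Notation r := rstep.
Local Notation d := dstep.

Let n_gt0 : 0 < n. Proof. lia. Qed.
Let m_gt0 : 0 < m. Proof. lia. Qed.

Lemma emb_inj : injective emb.
Proof.
move=> [a b] [c e] [/(congr1 val) + /(congr1 val)].
rewrite /= !inordK ?ltnS ?ltn_ord // => -[ac] [be].
by congr (_, _); apply: val_inj.
Qed.

Lemma card_tset : #|A| = #|S|.
Proof. by rewrite card_imset //; apply: emb_inj. Qed.

Lemma in_tgrid p : (p \in G) = (p.1 != 0%R) && (p.2 != 0%R).
Proof. by case: p => i j; rewrite in_setX !in_setC1. Qed.

Lemma card_tgrid : #|G| = n * m.
Proof. by rewrite cardsX !cardsC1 !card_ord. Qed.

Lemma inord0 N : inord 0 = 0%R :> 'I_N.+1.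
Proof. by apply: val_inj; rewrite /= inordK. Qed.

Lemma inord_neq0 N j : 0 < j <= N -> (inord j : 'I_N.+1) != 0%R.
Proof. by case/andP=> j0 jN; rewrite -val_eqE /= inordK //; lia. Qed.

Lemma tset_sub : A \subset G.
Proof.
apply/subsetP => _ /imsetP[u _ ->]; rewrite in_tgrid.
by rewrite !inord_neq0 //= ltn_ord.
Qed.

Lemma addr_r (p : T) : (p + r)%R = (p.1, (p.2 + inord 1)%R).
Proof. by case: p => a b; congr (_, _); rewrite /= inord0 addr0. Qed.
Lemma subr_r (p : T) : (p - r)%R = (p.1, (p.2 - inord 1)%R).
Proof. by case: p => a b; congr (_, _); rewrite /= inord0 subr0. Qed.
Lemma addr_d (p : T) : (p + d)%R = ((p.1 + inord 1)%R, p.2).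
Proof. by case: p => a b; congr (_, _); rewrite /= inord0 addr0. Qed.
Lemma subr_d (p : T) : (p - d)%R = ((p.1 - inord 1)%R, p.2).
Proof. by case: p => a b; congr (_, _); rewrite /= inord0 subr0. Qed.

Definition steps : seq T := [:: r; - r; d; - d]%R.

Lemma emb_adj u v : grid_adj u v -> (emb v - emb u)%R \in steps.
Proof.
case: u v => [a b] [c e]; rewrite /grid_adj /= /steps => adj.
have step N (i j : 'I_N) : i.+1 = j -> (inord j.+1 = inord i.+1 + inord 1 :> 'I_N.+1)%R.
  by move=> ij; rewrite inord_succ ?ij //; have := ltn_ord j; lia.
have sub (p q t : T) : (q = p + t -> q - p = t)%R by move=> ->; rewrite addrAC subrr add0r.
have subN (p q t : T) : (p = q + t -> q - p = - t)%R.
  by move=> ->; rewrite opprD addrA subrr add0r.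
have : (a = c :> nat /\ b.+1 = e) \/ (a = c :> nat /\ e.+1 = b) \/
         (b = e :> nat /\ a.+1 = c) \/ (b = e :> nat /\ c.+1 = a) by move: adj; lia.
case=> [|[|[]]] [/val_inj <- /step e1]; rewrite !inE.
- by rewrite (sub _ _ r) ?eqxx // addr_r /emb /= e1.
- by rewrite (subN _ _ r) ?eqxx ?orbT // addr_r /emb /= e1.
- by rewrite (sub _ _ d) ?eqxx ?orbT // addr_d /emb /= e1.
- by rewrite (subN _ _ d) ?eqxx ?orbT // addr_d /emb /= e1.
Qed.

Lemma tset_dom p : p \in G -> [|| p \in A, (p + r)%R \in A, (p - r)%R \in A,
                                 (p + d)%R \in A | (p - d)%R \in A].
Proof.
case: p => i j; rewrite in_tgrid /= => /andP[i0 j0].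
have unlift_k N (k : 'I_N.+1) : k != 0%R -> exists l : 'I_N, k = inord l.+1.
  move=> k0; have lt : k.-1 < N by have := ltn_ord k; move: k0; rewrite -val_eqE /=; lia.
  exists (Ordinal lt); apply: val_inj; by rewrite /= prednK ?inord_val // lt0n.
have [a ->] := unlift_k _ _ i0; have [b ->] := unlift_k _ _ j0.
have memA y : y \in S -> emb y \in A by apply: imset_f.
have /andP[_ /forallP/(_ (a, b))] := cdS; rewrite -/(emb (a, b)).
case/orP => [/memA -> // | /existsP[y /andP[/memA yA /emb_adj]]].
rewrite !inE => /or4P[] /eqP/(canRL (subrK _)); rewrite addrC => <-.
all: by rewrite yA ?orbT.
Qed.

Lemma tset_conn : {in A &, forall p q, connect (induced (fun p q => (q - p)%R \in steps) A) p q}.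
Proof.
move=> _ _ /imsetP[u uS ->] /imsetP[v vS ->].
have /andP[/forallP/(_ u)/implyP/(_ uS)/forallP/(_ v)/implyP/(_ vS) + _] := cdS.
case/connectP => s; elim: s u {uS} => [|w s IHs] u /=; first by move=> _ ->.
case/andP => /and3P[uS wS /emb_adj adj] sP lastv.
apply: connect_trans (IHs w sP lastv); apply: connect1.
by rewrite /induced /= !imset_f.
Qed.

Definition drank (p : T) := n - p.1.
Definition rrank (p : T) := m - p.2.

(** A nonzero sum excludes the wrap from N to 0, the only step that does not approach N. *)
Lemma succ_rank N (i : 'I_N.+1) : 0 < N -> (i + inord 1)%R != 0%R ->
  N - (i + inord 1)%R < N - i.
Proof.
move=> N0; rewrite -[i in (i + _)%R]inord_val inord_succ //; last by rewrite -ltnS.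
have := ltn_ord i; rewrite ltnS leq_eqVlt => /orP[/eqP-> | lt _].
  by rewrite inord_out // eqxx.
by rewrite inordK //; lia.
Qed.

Lemma tset_drank p : p \in A -> (p + d)%R \in A -> drank (p + d)%R < drank p.
Proof.
move=> _ /(subsetP tset_sub); rewrite in_tgrid addr_d => /andP[+ _].
exact: succ_rank.
Qed.

Lemma drank_r p : drank (p + r)%R = drank p.
Proof. by rewrite addr_r. Qed.

Lemma tset_rrank p : p \in A -> (p + r)%R \in A -> rrank (p + r)%R < rrank p.
Proof.
move=> _ /(subsetP tset_sub); rewrite in_tgrid addr_r => /andP[_].
exact: succ_rank.
Qed.

Lemma tset_outside p : p \notin G -> (nbrs A r p == 0) || (nbrs A d p == 0).
Proof.
rewrite in_tgrid negb_and !negbK.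
have notin (q : T) : (q.1 == 0%R) || (q.2 == 0%R) -> q \in A = false.
  move=> q0; apply: contraTF q0 => /(subsetP tset_sub).
  by rewrite in_tgrid -negb_or.
rewrite /nbrs addr_r subr_r addr_d subr_d.
by case/orP => p0; apply/orP; [left | right]; rewrite !notin //= p0 ?orbT.
Qed.

Lemma tset_border : 4 <= \sum_(p | p \notin G) (nbrs A r p + nbrs A d p).
Proof.
pose X i j : nat := ((inord i, inord j) : T) \in A.
have X0 i j : (i == 0) || (n < i) || (j == 0) || (m < j) -> X i j = 0.
  move=> out; apply/eqP; rewrite eqb0; apply: contraTN out => /(subsetP tset_sub).
  rewrite in_tgrid /=.
  case: (posnP i) => [->|i0]; first by rewrite inord0 eqxx.
  case: (posnP j) => [->|j0]; first by rewrite inord0 eqxx andbF.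
  case: (leqP i n) => [_|/inord_out->]; last by rewrite eqxx.
  by case: (leqP j m) => [_|/inord_out->]; last by rewrite eqxx andbF.
have Xdom i j : 0 < i <= n -> 0 < j <= m ->
    0 < X i j + X i j.+1 + X i j.-1 + X i.+1 j + X i.-1 j.
  move=> iP jP; have := @tset_dom (inord i, inord j).
  rewrite in_tgrid !inord_neq0 //= => /(_ isT).
  rewrite addr_r subr_r addr_d subr_d /= !inord_succ ?inord_pred //; try lia.
  by rewrite /X; do 5!case: (_ \in A).
(* On the torus a padding vertex of row 0 touches both row 1 and row n. *)
have Xrow j : X 1 j + X n j <= nbrs A r (inord 0, inord j) + nbrs A d (inord 0, inord j).
  apply: leq_trans (leq_addl _ _); rewrite /nbrs addr_d subr_d /=.
  by rewrite inord_succ // inord_pred0.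
have Xcol i : X i 1 + X i m <= nbrs A r (inord i, inord 0) + nbrs A d (inord i, inord 0).
  apply: leq_trans (leq_addr _ _); rewrite /nbrs addr_r subr_r /=.
  by rewrite inord_succ // inord_pred0.
(* Each grid corner is dominated by itself or by the next vertex on one of its two sides. These
   positions suffice, and since m, n >= 4 they are distinct and no dominator serves two corners. *)
pose l : seq T := [seq (inord 0, inord j) | j <- [:: 1; 2; m.-1; m]]
            ++ [seq (inord i, inord 0) | i <- [:: 1; 2; n.-1; n]].
have inordE N a b : a <= N -> b <= N -> (inord a == inord b :> 'I_N.+1) = (a == b).
  by move=> aN bN; rewrite -val_eqE /= !inordK.
have l_uniq : uniq l.
  by rewrite /l /= !inE !xpair_eqE !inordE //; lia.
have l_out p : p \in l -> p \notin G.
  rewrite in_tgrid mem_cat => /orP[] /mapP[k _ ->] /=;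
  by rewrite inord0 eqxx ?andbF.
apply: (@leq_trans (\sum_(p <- l) (nbrs A r p + nbrs A d p))); last first.
  rewrite big_uniq //= [leqLHS]big_mkcond [leqRHS]big_mkcond; apply: leq_sum => p _.
  by case: ifP => // /l_out ->.
have n_n : 0 < n <= n by rewrite n_gt0 /=.
have m_m : 0 < m <= m by rewrite m_gt0 /=.
have := Xdom 1 1 n_gt0 m_gt0; rewrite (X0 1 0) ?(X0 0 1) ?orbT //= => c1.
have := Xdom 1 m n_gt0 m_m; rewrite (X0 1 m.+1) ?(X0 0 m) ?ltnSn ?orbT //= => c2.
have := Xdom n 1 n_n m_gt0; rewrite (X0 n 0) ?(X0 n.+1 1) ?ltnSn ?orbT //= => c3.
have := Xdom n m n_n m_m; rewrite (X0 n m.+1) ?(X0 n.+1 m) ?ltnSn ?orbT //= => c4.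
have : 4 <= \sum_(j <- [:: 1; 2; m.-1; m]) (X 1 j + X n j)
         + \sum_(i <- [:: 1; 2; n.-1; n]) (X i 1 + X i m).
  by rewrite !big_cons !big_nil; move: X c1 c2 c3 c4 {X0 Xdom Xrow Xcol} => X; lia.
move/leq_trans; apply; rewrite /l big_cat !big_map.
by apply: leq_add; apply: leq_sum => k _; [exact: Xrow | exact: Xcol].
Qed.

Lemma tset_area_r : n * m + 2 * ends A r <= 3 * #|S|.
Proof.
rewrite -card_tgrid -card_tset.
exact: (area_bound_r tset_sub tset_dom tset_outside tset_border tset_drank
                     drank_r tset_conn).
Qed.

Lemma tset_area_d : n * m + 2 * ends A d <= 3 * #|S|.
Proof.
rewrite -card_tgrid -card_tset.
exact: (area_bound_d tset_sub tset_dom tset_outside tset_border tset_drank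
                     drank_r tset_conn).
Qed.

(** The area bound excludes a single vertex, so a path from [p] to another vertex has a first
    step. *)
Lemma tset_neighbor p : p \in A ->
  [|| (p + r)%R \in A, (p - r)%R \in A, (p + d)%R \in A | (p - d)%R \in A].
Proof.
move=> pA.
have [q qA qp] : exists2 q, q \in A & q \notin [set p].
  apply/subsetPn; apply/negP => /subset_leq_card; rewrite cards1 card_tset.
  have := tset_area_r; have : 4 * 4 <= n * m by apply: leq_mul.
  lia.
have /connectP[[|t s] /=] := tset_conn pA qA; first by move=> _ qE; rewrite qE inE eqxx in qp.
case/andP => /and3P[_ tA adj] _ _; move: adj; rewrite !inE.
case/or4P => /eqP/(canRL (subrK _)); rewrite addrC => <-.
all: by rewrite tA ?orbT.
Qed.

Lemma tset_lines : n <= 3 * ends A r \/ m <= 3 * ends A d.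
Proof.
pose rows := [set p.1 | p : T in [set p | [&& p \in A, (p + r)%R \notin A & (p - r)%R \in A]]].
pose cols := [set p.2 | p : T in [set p | [&& p \in A, (p + d)%R \notin A & (p - d)%R \in A]]].
have rowE p : edge A r p -> p.1 \in rows.
  case/(run_has_end (f := fst) (rk := rrank)) => [q | q | q [<- qend]].
  - by rewrite addr_r.
  - exact: tset_rrank.
  by apply/imsetP; exists q; rewrite ?inE.
have colE p : edge A d p -> p.2 \in cols.
  case/(run_has_end (f := snd) (rk := drank)) => [q | q | q [<- qend]].
  - by rewrite addr_d.
  - exact: tset_drank.
  by apply/imsetP; exists q; rewrite ?inE.
(* A vertex in a row without horizontal edge has only vertical neighbours, and it has at least
   one. *)
have near_col p : p \in A -> p.1 \notin rows -> p.2 \in cols.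
  move=> pA p1N; case/or4P: (tset_neighbor pA) => qA.
  - by case/negP: p1N; apply: rowE; rewrite /edge pA.
  - case/negP: p1N; have := rowE (p - r)%R; rewrite subr_r /=; apply.
    by rewrite -subr_r /edge qA subrK.
  - by apply: colE; rewrite /edge pA.
  have := colE (p - d)%R; rewrite subr_d /=; apply.
  by rewrite -subr_d /edge qA subrK.
have [/forallP cov | ] := boolP [forall i, (i != 0%R) ==>
    [|| i \in rows, (i + inord 1)%R \in rows | (i - inord 1)%R \in rows]].
  left; apply: leq_trans (leq_mul (leqnn 3) (card_ends_ge A r fst)).
  by apply: (@card_three_translates _ rows (inord 1)) => i; apply/implyP.
rewrite negb_forall => /existsP[i]; rewrite negb_imply !negb_or.
case/andP=> i0 /and3P[iN iuN idN]; right.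
apply: leq_trans (leq_mul (leqnn 3) (card_ends_ge A d snd)).
apply: (@card_three_translates _ cols (inord 1)) => j j0.
(* The dominator of (i, j) lies in one of the rows i - 1, i, i + 1, all outside [rows], so its
   column, one of j - 1, j, j + 1, belongs to [cols]. *)
have := @tset_dom (i, j); rewrite in_tgrid i0 j0 => /(_ isT).
rewrite addr_r subr_r addr_d subr_d /=.
by case/or4P=> [||| /orP[]] /near_col /= ->; rewrite ?orbT.
Qed.


End Grid.

(** * From the area bounds to the ceilings *)

Local Open Scope ring_scope.

Theorem theorem2 (m n : nat) (hm : (4 <= m)%N) (hn : (4 <= n)%N)
    (S : {set 'I_n * 'I_m}) (hS : connected_dominating (@grid_adj n m) S) :
  Num.ceil (((m * n)%:R
             + (Num.ceil (3 / 2 * (Num.ceil ((minn m n)%:R / 3 : rat))%:~R : rat))%:~R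
             + 1) / 3 : rat)
    <= #|S|%:Z.
Proof.
have [h minh areah] : exists2 h, (minn m n <= 3 * h)%N & (m * n + 2 * h <= 3 * #|S|)%N.
  case: (tset_lines hn hm hS) => le_h.
    by exists (ends (tset S) (rstep n m)); [lia | rewrite mulnC tset_area_r].
  by exists (ends (tset S) (dstep n m)); [lia | rewrite mulnC tset_area_d].
(* This makes 3h/2 <= 2h - 1, so the inner ceiling plus 1 is at most 2h. *)
have h_ge2 : (2 <= h)%N by lia.
have ceil_min : Num.ceil ((minn m n)%:R / 3 : rat) <= h%:Z.
  rewrite ceil_le_int ler_pdivrMr // mulrC -[h%:~R]/(h%:R) -natrM ler_nat; lia.
have ceil_32 : Num.ceil (3 / 2 * (Num.ceil ((minn m n)%:R / 3 : rat))%:~R : rat) <= (2 * h)%:Z - 1.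
  rewrite ceil_le_int.
  have : (Num.ceil ((minn m n)%:R / 3 : rat))%:~R <= h%:R :> rat by rewrite -[h%:R]/(h%:~R) ler_int.
  have : 2 <= h%:R :> rat by rewrite ler_nat.
  rewrite rmorphB /= -[(2 * h)%:~R]/((2 * h)%:R) natrM; lra.
rewrite ceil_le_int ler_pdivrMr //.
move: ceil_32; set c := Num.ceil (3 / 2 * _); rewrite -(ler_int rat) rmorphB /= => c_le.
move: areah; rewrite -(ler_nat rat) natrD => areah.
have -> : #|S|%:~R * 3 = (3 * #|S|)%:R :> rat by rewrite natrM mulrC.
rewrite -[(2 * h)%:~R]/((2 * h)%:R) in c_le; lra.
Qed.
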